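(* Let $n \geq 3$ be an integer. Let $G_{\mathrm{pr}}(\mathbb{F}_2^n)$ be the phase-rotation distance graph over $\mathbb{F}_2$, and let $\alpha_2$ denote the $2$-independence number. Then \[ \alpha_2(G_{\mathrm{pr}}(\mathbb{F}_2^n)) \leq \begin{cases} 2^n \frac{n-2}{n(n+4)} & \text{if } n \equiv 0 \pmod 4, \\ 2^n \frac{n-3}{(n+3)(n-1)} & \text{if } n \equiv 1 \pmod 4, \\ 2^n \frac{1}{n+2} & \text{if } n \equiv 2 \pmod 4, \\ 2^n \frac{1}{n+5} & \text{if } n \equiv 3 \pmod 4 . \end{cases} \]
   Context: Let $q$ be a prime power (here $q=2$). Let $\mathbf{e}_1,\ldots,\mathbf{e}_n$ be the standard basis of $\mathbb{F}_q^n$ and $\mathbf{1}$ the all-ones vector. Put $F_i=\mathrm{span}(\mathbf{e}_i)$ for $i=1,\ldots,n$ and $F_{n+1}=\mathrm{span}(\mathbf{1})$. The phase-rotation weight of $\mathbf{x}\in\mathbb{F}_q^n$ is $w_{\mathrm{pr}}(\mathbf{x})=\min\{|I| : I\subseteq\{1,\ldots,n+1\},\ \mathbf{x}\in\mathrm{span}(\bigcup_{i\in I}F_i)\}$, and the phase-rotation distance is $d_{\mathrm{pr}}(\mathbf{x},\mathbf{y})=w_{\mathrm{pr}}(\mathbf{x}-\mathbf{y})$. The phase-rotation distance graph $G_{\mathrm{pr}}(\mathbb{F}_q^n)$ is the graph with vertex set $\mathbb{F}_q^n$ in which $\mathbf{x},\mathbf{y}$ are adjacent if and only if $d_{\mathrm{pr}}(\mathbf{x},\mathbf{y})=1$.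 For a graph $G$, the $k$-independence number $\alpha_k(G)$ is the size of the largest set of vertices such that any two distinct vertices in the set are at geodesic distance greater than $k$ in $G$. *)

(* Defs.v *)
From mathcomp Require Import all_boot all_order all_algebra.
Set Implicit Arguments.
Unset Strict Implicit.
Unset Printing Implicit Defensive.
Import GRing.Theory.

Section Graph.
Variables (T : finType) (e : rel T).

Definition walk (m : nat) (x y : T) : bool :=
  [exists p : m.-tuple T, path e x p && (last x p == y)].

(* [None] is the infinite distance. The bound #|T| on the search loses nothing:
   connected vertices are joined by a duplicate-free path (see gdist_gtP). *)
Definition gdist (x y : T) : option nat :=
  if connect e x y then Some (find (fun m => walk m x y) (iota 0 #|T|))
  else None.

Definition gdist_gt (k : nat) (d : option nat) : bool :=
  if d is Some m then k < m else true.

Definition k_independent (k : nat) (S : {set T}) : bool :=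
  [forall x in S, forall y in S, (x != y) ==> gdist_gt k (gdist x y)].

Definition alpha (k : nat) : nat := \max_(S : {set T} | k_independent k S) #|S|.

Lemma walkP m x y :
  reflect (exists p, [/\ path e x p, last x p = y & size p = m]) (walk m x y).
Proof.
apply: (iffP existsP) => [[p /andP[xp /eqP py]]|[p [xp py sp]]].
  by exists p; rewrite size_tuple.
by move/eqP: sp => sp; exists (Tuple sp); rewrite /= xp py eqxx.
Qed.

Lemma gdist_gtP k x y :
  reflect (forall p, path e x p -> last x p = y -> k < size p)
          (gdist_gt k (gdist x y)).
Proof.
rewrite /gdist; case: (boolP (connect e x y)) => /= xy; last first.
  apply: ReflectT => p xp py; case/negP: xy; apply/connectP.
  by exists p.
set f := find _ _.
have Hhas : has (fun m => walk m x y) (iota 0 #|T|).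
  case/connectP: xy => p xp ->; case/shortenP: xp => p' xp' up' _.
  apply/hasP; exists (size p'); last by apply/walkP; exists p'.
  rewrite mem_iota add0n /=.
  by move: (card_uniqP up') (max_card (mem (x :: p'))) => /= ->.
have fT : f < #|T| by move: Hhas; rewrite has_find size_iota.
have wf : walk f x y by move: (nth_find 0 Hhas); rewrite nth_iota.
apply: (iffP idP) => [kf p xp py|H]; last first.
  by case/walkP: wf => p [xp py <-]; apply: H.
apply: leq_trans kf _; rewrite leqNgt; apply/negP => pf.
have := before_find 0 pf; rewrite nth_iota ?(ltn_trans pf) // add0n.
by move=> /negbT/negP; apply; apply/walkP; exists p.
Qed.

End Graph.

Section PhaseRotation.
Local Open Scope ring_scope.
Variables (F : finFieldType) (n : nat).
Implicit Types (x y : 'rV[F]_n) (I : {set 'I_n.+1}).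

(* Indices run over 0..n; the last one, [ord_max], carries the all-ones line. *)
Definition pr_line (i : 'I_n.+1) : {vspace 'rV[F]_n} :=
  if unlift ord_max i is Some j then <[delta_mx 0%R j]>%VS
  else <[const_mx 1%R]>%VS.

Definition pr_span I : {vspace 'rV[F]_n} := (\sum_(i in I) pr_line i)%VS.

(* The default [setT] is itself admissible, by pr_span_setT. *)
Definition pr_weight x : nat :=
  #|[arg min_(I < [set: 'I_n.+1] | x \in pr_span I) #|I|]|.

Definition pr_dist x y : nat := pr_weight (x - y).

Definition pr_adj : rel 'rV[F]_n := fun x y => pr_dist x y == 1%N.

Lemma pr_span_setT x : x \in pr_span setT.
Proof.
rewrite [x]row_sum_delta; apply: memv_suml => j _; apply: memvZ.
apply: (subvP (sumv_sup (lift ord_max j) _ (subvv _))); first by rewrite inE.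
by rewrite /pr_line liftK memv_line.
Qed.

Lemma pr_weightP x m :
  reflect (exists2 I, x \in pr_span I & (#|I| <= m)%N) (pr_weight x <= m)%N.
Proof.
rewrite /pr_weight; case: arg_minnP => [|I xI Imin]; first exact: pr_span_setT.
by apply: (iffP idP) => [|[J xJ]]; [exists I | apply: leq_trans (Imin J xJ)].
Qed.

Lemma pr_adj_irr : irreflexive pr_adj.
Proof.
move=> x; rewrite /pr_adj /pr_dist subrr.
suff: (pr_weight 0 <= 0)%N by rewrite leqn0 => /eqP ->.
by apply/pr_weightP; exists set0; rewrite ?mem0v ?cards0.
Qed.

Lemma pr_adj_sym : symmetric pr_adj.
Proof.
have H x y : (pr_dist y x <= pr_dist x y)%N.
  have /pr_weightP[I xI lI] := leqnn (pr_dist x y).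
  by apply/pr_weightP; exists I; rewrite // -opprB memvN.
move=> x y; rewrite /pr_adj; congr (_ == _).
by apply/eqP; rewrite eqn_leq !H.
Qed.

End PhaseRotation.

(* Main.v *)
Require Import Defs.
From mathcomp Require Import all_boot all_order all_algebra.
From mathcomp Require Import ring lra zify.
Import GRing.Theory Num.Theory.
Set Implicit Arguments.
Unset Strict Implicit.
Local Open Scope ring_scope.

(** The graph is the Cayley graph of [F_2^n] with connection set
    [g_0, ..., g_n], where [g_0 + ... + g_n = 0].  The character indexed by [a]
    is an eigenvector with eigenvalue [lambda a = \sum_i chi a (g_i)], a sum of
    [m = n + 1] signs of product 1, so that [lambda a] is congruent to [m] mod 4.
    Hence for [r] congruent to [m] mod 4 the polynomial
    [p = (X - r) (X - (r + 4))] is nonnegative on the spectrum.  If [S] is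
    2-independent and [f] is the Fourier transform of its indicator function,
    then [\sum_a f(a)^2 p(lambda a) = 2^n #|S| (m + r (r + 4))], while the term
    [a = 0] alone is [#|S|^2 p(m)].  The four cases of the bound are
    [r = -3, -2, -1, -4]. *)

(** * Characters of [F_2^n] and their orthogonality *)

Section Characters.
Variable n : nat.
Implicit Types a x y z : 'rV['F_2]_n.

Definition sgn2 (u : 'F_2) : rat := (-1) ^+ (u : nat).

Lemma sgn2D u v : sgn2 (u + v) = sgn2 u * sgn2 v.
Proof.
by case: u v => [[|[|//]] hu] [[|[|//]] hv]; rewrite /sgn2 /= ?expr0 ?expr1; ring.
Qed.

Lemma F2_neq0 (u : 'F_2) : u != 0 -> u = 1.
Proof. by case: u => [[|[|//]] hu] // _; apply: val_inj. Qed.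

Lemma addrr_F2 z : z + z = 0.
Proof.
by apply/rowP => j; rewrite !mxE; case: (z 0 j) => [[|[|//]] h]; apply: val_inj.
Qed.

Lemma oppr_F2 z : - z = z.
Proof. by apply/eqP; rewrite eq_sym -addr_eq0 addrr_F2. Qed.

Lemma addr_eq0_F2 x y : (x + y == 0) = (x == y).
Proof. by rewrite addr_eq0 oppr_F2. Qed.

Definition chi a x : rat := sgn2 ((a *m x^T) 0 0).

Lemma chiDr a x y : chi a (x + y) = chi a x * chi a y.
Proof. by rewrite /chi linearD mulmxDr mxE sgn2D. Qed.

Lemma chiDl a b x : chi (a + b) x = chi a x * chi b x.
Proof. by rewrite /chi mulmxDl mxE sgn2D. Qed.

Lemma chi0l x : chi 0 x = 1.
Proof. by rewrite /chi mul0mx mxE. Qed.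

Lemma chi0r a : chi a 0 = 1.
Proof. by rewrite /chi trmx0 mulmx0 mxE. Qed.

Lemma chi_sum_r a (I : finType) (g : I -> 'rV['F_2]_n) :
  chi a (\sum_i g i) = \prod_i chi a (g i).
Proof. exact: (big_morph _ (chiDr a) (chi0r a)). Qed.

Lemma sum_chi z : \sum_a chi a z = 2 ^+ n * (z == 0)%:R.
Proof.
have [->|/rV0Pn[j zj]] := eqVneq z 0.
  rewrite (eq_bigr (fun=> 1)) => [|a _]; last exact: chi0r.
  by rewrite sumr_const card_mx card_Fp // mul1n natrX mulr1.
rewrite mulr0; set s := \sum_a _.
(* Translating [a] by the basis vector at a coordinate [j] where [z] is nonzero flips every sign. *)
suff : s = - s by lra.
rewrite {1}/s (reindex_inj (addrI (delta_mx 0 j))) /=.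
rewrite -mulN1r mulr_sumr; apply: eq_bigr => a _.
by rewrite chiDl {1}/chi -rowE !mxE (F2_neq0 zj).
Qed.

End Characters.

(** * Spectral bound for packings in a Cayley graph *)

Lemma sum_signs_mod4 (I : finType) (b : I -> nat) :
  (forall i, (b i <= 1)%N) -> \prod_i (-1) ^+ b i = 1 :> rat ->
  exists k : nat, \sum_i (-1) ^+ b i = #|I|%:R - 4 * k%:R :> rat.
Proof.
(* The product being 1, the number of minus signs is even; each of them lowers the sum by 2. *)
move=> b1; rewrite prodrXr => even_b; exists ((\sum_i b i)./2).
have odd_b : odd (\sum_i b i) = false.
  by move: even_b; rewrite -signr_odd; case: odd => //; rewrite expr1; lra.
rewrite (eq_bigr (fun i => 1 - 2 * (b i)%:R)) => [|i _]; last first.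
  by case: (b i) (b1 i) => [|[|//]] _; rewrite ?expr0 ?expr1; lra.
rewrite sumrB sumr_const -mulr_sumr -natr_sum; congr (_ - _).
have {1}-> : (\sum_i b i = 2 * (\sum_i b i)./2)%N.
  by rewrite -[LHS]odd_double_half odd_b add0n mul2n.
by rewrite natrM mulrA -natrM.
Qed.

(** A product of characters is a character at a sum, so orthogonality turns the terms of degree 2, 1
    and 0 into counts of walks of that length from 0 to [z] with steps [g i]. *)
Lemma sum_chi_quadratic (n : nat) (I : finType) (g : I -> 'rV['F_2]_n)
    (u v : rat) (z : 'rV['F_2]_n) :
  let lam a := \sum_i chi a (g i) in
  \sum_a chi a z * ((lam a - u) * (lam a - v)) =
  2 ^+ n * (\sum_i \sum_j (z == g i + g j)%:R - (u + v) * \sum_i (z == g i)%:R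
            + u * v * (z == 0)%:R).
Proof.
move=> lam.
have E w : 2 ^+ n * (z == w)%:R = \sum_a chi a z * chi a w.
  rewrite -addr_eq0_F2 -sum_chi; apply: eq_bigr => a _; exact: chiDr.
have E1 : 2 ^+ n * \sum_i (z == g i)%:R = \sum_a chi a z * lam a.
  rewrite mulr_sumr; under eq_bigr do rewrite E.
  by rewrite exchange_big; apply: eq_bigr => a _; rewrite mulr_sumr.
have E2 : 2 ^+ n * \sum_i \sum_j (z == g i + g j)%:R
    = \sum_a chi a z * (lam a * lam a).
  rewrite mulr_sumr; under eq_bigr do rewrite mulr_sumr.
  under eq_bigr do under eq_bigr do rewrite E.
  under eq_bigr do rewrite exchange_big /=.
  rewrite exchange_big; apply: eq_bigr => a _ /=.
  rewrite [lam a * _]mulr_suml mulr_sumr; apply: eq_bigr => i _.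
  rewrite !mulr_sumr; apply: eq_bigr => j _; by rewrite chiDr.
rewrite mulrDr mulrBr E2 [_ * (_ * \sum_i _)]mulrCA E1.
rewrite [_ * (_ * (z == 0)%:R)]mulrCA -sum_chi !mulr_sumr -sumrB -big_split /=.
by apply: eq_bigr => a _; ring.
Qed.

(** The integer [t] places [r] in the residue class modulo 4 of the eigenvalues, so that none lies
    strictly between [r] and [r + 4]. *)
Lemma two_packing_bound (n : nat) (I : finType) (g : I -> 'rV['F_2]_n)
    (S : {set 'rV['F_2]_n}) (r : rat) (t : int) :
  r = #|I|%:R - 4 * t%:~R -> (4 <= #|I|)%N -> \sum_i g i = 0 -> injective g ->
  {in S &, forall x y i, x + y != g i} ->
  {in S &, forall x y i j, x + y = g i + g j -> x = y} ->
  #|S|%:R * ((#|I|%:R - r) * (#|I|%:R - (r + 4)))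
    <= 2 ^+ n * (#|I|%:R + r * (r + 4)).
Proof.
set m : rat := #|I|%:R => rE m4 sum_g inj_g dist1 dist2.
(* The main argument cancels a factor [#|S|]; for the empty set only the sign of the right-hand side
   matters. *)
have [->|S_neq0] := eqVneq S set0.
  rewrite cards0 mul0r mulr_ge0 ?exprn_ge0 //.
  have m_ge4 : (4 : rat) <= m by rewrite (ler_nat _ 4).
  have -> : m + r * (r + 4) = (m - 4) + (r + 2) ^+ 2 by ring.
  by rewrite addr_ge0 ?sqr_ge0 // subr_ge0.
pose f a : rat := \sum_(x in S) chi a x.
pose lam a : rat := \sum_i chi a (g i).
pose p (l : rat) := (l - r) * (l - (r + 4)).
have p_ge0 a : 0 <= p (lam a).
  have [||k lamE] := @sum_signs_mod4 I (fun i => (a *m (g i)^T) 0 0).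
  - by move=> i; rewrite -ltnS ltn_ord.
  - by rewrite -[RHS](chi0r a) -sum_g chi_sum_r.
  (* A product of two consecutive integers is nonnegative. *)
  have -> : p (lam a) = 16 * ((t - k%:Z) * (t - k%:Z - 1))%:~R.
    by rewrite /p [lam a]lamE rE !rmorphM !rmorphB /= -/m; ring.
  rewrite mulr_ge0 // ler0z; set d : int := t - _.
  have [d_le0|d_ge1] : (d <= 0 \/ 1 <= d)%R by lia.
    by rewrite mulr_le0 //; lia.
  by rewrite mulr_ge0 //; lia.
have p0 : f 0 ^+ 2 * p (lam 0) = #|S|%:R ^+ 2 * p m.
  rewrite /f /lam; under eq_bigr do rewrite chi0l.
  by under [\sum_i _]eq_bigr do rewrite chi0l; rewrite !sumr_const.
have sumN x y : x \in S -> y \in S ->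
    \sum_a chi a (x + y) * p (lam a)
    = 2 ^+ n * (m + r * (r + 4)) * (x == y)%:R.
  move=> xS yS; rewrite sum_chi_quadratic addr_eq0_F2.
  (* For [x = y], [dist1] says that no [g i] is zero. *)
  have -> : \sum_i (x + y == g i)%:R = 0 :> rat.
    by rewrite big1 // => i _; rewrite (negbTE (dist1 x y xS yS i)).
  rewrite mulr0 subr0.
  have [->|neq_xy] := eqVneq x y.
    rewrite !mulr1 addrr_F2; congr (_ * (_ + _)).
    rewrite /m -sum1_card natr_sum; apply: eq_bigr => i _.
    rewrite (bigD1 i) //= addrr_F2 eqxx big1 ?addr0 // => j ji.
    by rewrite eq_sym addr_eq0_F2 (inj_eq inj_g) eq_sym (negbTE ji).
  rewrite !mulr0 addr0 big1 ?mulr0 // => i _; rewrite big1 // => j _.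
  by case: eqP => // /(dist2 x y xS yS) /eqP; rewrite (negbTE neq_xy).
have fourier : \sum_a f a ^+ 2 * p (lam a)
    = 2 ^+ n * (m + r * (r + 4)) * #|S|%:R.
  (* Expand the square of [f a]; by [sumN] only the diagonal pairs survive. *)
  transitivity (\sum_(x in S) \sum_(y in S) \sum_a chi a (x + y) * p (lam a)).
    rewrite [RHS](eq_bigr _ (fun x _ => exchange_big _ _ _ _ _ _)) exchange_big /=.
    apply: eq_bigr => a _; rewrite expr2 mulr_suml mulr_suml.
    apply: eq_bigr => x _; rewrite mulr_sumr mulr_suml.
    by apply: eq_bigr => y _; rewrite chiDr.
  rewrite -sum1_card natr_sum mulr_sumr; apply: eq_bigr => x xS.
  rewrite (bigD1 x) //= sumN // eqxx big1 ?addr0 // => y /andP[yS yx].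
  by rewrite sumN // eq_sym (negbTE yx) mulr0.
have S_gt0 : 0 < #|S|%:R :> rat by rewrite ltr0n card_gt0.
rewrite -(ler_pM2l S_gt0) [leLHS]mulrA [leRHS]mulrC -fourier.
have -> : #|S|%:R * #|S|%:R * ((m - r) * (m - (r + 4))) = f 0 ^+ 2 * p (lam 0).
  by rewrite p0 expr2.
(* All terms other than [a = 0] are nonnegative and are dropped. *)
by rewrite (bigD1 0) //= lerDl sumr_ge0 // => a _; rewrite mulr_ge0 ?sqr_ge0.
Qed.

(** * The phase-rotation graph as a Cayley graph *)

Section Generators.
Variables (F : finFieldType) (n : nat).
Implicit Types x y : 'rV[F]_n.

Definition pr_gen (i : 'I_n.+1) : 'rV[F]_n :=
  if unlift ord_max i is Some j then delta_mx 0 j else const_mx 1.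

Lemma pr_lineE i : pr_line F i = <[pr_gen i]>%VS.
Proof. by rewrite /pr_line /pr_gen; case: unlift. Qed.

Lemma pr_gen_neq0 i : (0 < n)%N -> pr_gen i != 0.
Proof.
move=> n_gt0; rewrite /pr_gen; case: unlift => [j|]; apply/rV0Pn.
  by exists j; rewrite !mxE !eqxx oner_neq0.
by exists (Ordinal n_gt0); rewrite mxE oner_neq0.
Qed.

(** A second coordinate separates the all-ones vector from a basis vector; for [n = 1] the two
    coincide. *)
Lemma pr_gen_inj : (1 < n)%N -> injective pr_gen.
Proof.
move=> n_gt1.
have delta_const (j : 'I_n) : delta_mx 0 j != const_mx 1 :> 'rV[F]_n.
  apply/eqP => /rowP eq_jc.
  have [k kj] : exists k : 'I_n, k != j.
    have : (0 < #|predC1 j|)%N by rewrite cardC1 card_ord; lia.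
    by case/card_gt0P => k; exists k.
  have := eq_jc k; rewrite !mxE eqxx (negbTE kj) => /eqP.
  by rewrite eq_sym oner_eq0.
move=> i1 i2; rewrite /pr_gen.
case: unliftP => [j1|] ->; case: unliftP => [j2|] -> // E.
- have /rowP/(_ j1)/eqP := E; rewrite !mxE !eqxx /=.
  by have [->|_] := eqVneq j1 j2; rewrite // oner_eq0.
- by case/eqP: (delta_const j1).
- by case/eqP: (delta_const j2).
Qed.

Lemma pr_gen_adj x y i : (0 < n)%N -> x - y = pr_gen i -> pr_adj x y.
Proof.
move=> n_gt0 xy; rewrite /pr_adj /pr_dist xy eqn_leq; apply/andP; split.
  apply/pr_weightP; exists [set i]; last by rewrite cards1.
  by rewrite /pr_span big_set1 pr_lineE memv_line.
rewrite ltnNge; apply/pr_weightP => -[J].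
rewrite leqn0 cards_eq0 => iJ /eqP J0; move: iJ.
by rewrite J0 /pr_span big_set0 memv0 (negbTE (pr_gen_neq0 i n_gt0)).
Qed.

End Generators.

(** The basis vectors add up to the all-ones vector, which cancels the last generator in
    characteristic 2. *)
Lemma sum_pr_gen_F2 n : \sum_i @pr_gen 'F_2 n i = 0.
Proof.
have gen_lift (j : 'I_n) : @pr_gen 'F_2 n (widen_ord (leqnSn n) j) = delta_mx 0 j.
  have -> : widen_ord (leqnSn n) j = lift ord_max j.
    by apply: val_inj; exact: esym (lift_max j).
  by rewrite /pr_gen liftK.
rewrite big_ord_recr /= (eq_bigr _ (fun j _ => gen_lift j)).
rewrite {1}/pr_gen unlift_none -[RHS](addrr_F2 (const_mx 1)); congr (_ + _).
by rewrite [RHS]row_sum_delta; apply: eq_bigr => j _; rewrite mxE scale1r.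
Qed.

Lemma pr_two_independent_bound (n t : nat) (r : rat) (S : {set 'rV['F_2]_n}) :
  (3 <= n)%N -> r = n.+1%:R - 4 * t%:R -> k_independent (@pr_adj 'F_2 n) 2 S ->
  #|S|%:R * ((n.+1%:R - r) * (n.+1%:R - (r + 4)))
    <= 2 ^+ n * (n.+1%:R + r * (r + 4)).
Proof.
move=> n_ge3 rE indS; have n_gt0 : (0 < n)%N by lia.
have far x y : x \in S -> y \in S -> x != y ->
    forall p, path (@pr_adj 'F_2 n) x p -> last x p = y -> (2 < size p)%N.
  move=> xS yS xy; apply/gdist_gtP.
  by move: indS => /forall_inP/(_ x xS)/forall_inP/(_ y yS)/implyP; apply.
have adj_gen x i : pr_adj x (x + @pr_gen 'F_2 n i).
  by apply: (@pr_gen_adj _ _ _ _ i) => //; rewrite opprD addrA subrr sub0r oppr_F2.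
have sumE (x y z : 'rV['F_2]_n) : x + y = z -> x + z = y.
  by move=> <-; rewrite addrA addrr_F2 add0r.
have := @two_packing_bound n 'I_n.+1 (@pr_gen 'F_2 n) S r t.
rewrite card_ord; apply=> //.
- exact: sum_pr_gen_F2.
- by apply: pr_gen_inj; lia.
(* Writing [x + y] as one or two generators yields a path of length 1 or 2 from [x] to [y], too
   short for distinct points of [S]. *)
- move=> x y xS yS i; apply/eqP => /sumE xy.
  have neq_xy : x != y.
    by rewrite -xy -subr_eq0 opprD addrA subrr sub0r oppr_F2 pr_gen_neq0.
  have := far x y xS yS neq_xy [:: y].
  by rewrite /= -{1}xy adj_gen => /(_ isT erefl).
- move=> x y xS yS i j /sumE xy; apply/eqP/negPn/negP => neq_xy.
  have adj_y : pr_adj (x + pr_gen _ i) y by rewrite -xy addrA.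
  have := far x y xS yS neq_xy [:: x + pr_gen _ i; y].
  by rewrite /= adj_gen adj_y => /(_ isT erefl).
Qed.

Theorem theorem40 (n : nat) (hn : (3 <= n)%N) :
  (alpha (@pr_adj 'F_2 n) 2)%:R <=
    match (n %% 4)%N with
    | 0%N => 2 ^+ n * ((n%:R - 2) / (n%:R * (n%:R + 4)))
    | 1%N => 2 ^+ n * ((n%:R - 3) / ((n%:R + 3) * (n%:R - 1)))
    | 2%N => 2 ^+ n * (1 / (n%:R + 2))
    | _ => 2 ^+ n * (1 / (n%:R + 5))
    end :> rat.
Proof.
have [|S indS maxS] := @eq_bigmax_cond _ (k_independent (@pr_adj 'F_2 n) 2)
                         (fun S => #|S|).
  by apply/card_gt0P; exists set0; apply/forall_inP => x; rewrite inE.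
rewrite [alpha _ _]maxS.
have n_ge3 : (3 : rat) <= n%:R by rewrite (ler_nat _ 3).
(* [c] is the common factor to cancel from the two sides of the bound. *)
have ratio (t : nat) (r c num den : rat) :
    r = n.+1%:R - 4 * t%:R -> 0 < c -> 0 < den ->
    (n.+1%:R - r) * (n.+1%:R - (r + 4)) = c * den ->
    n.+1%:R + r * (r + 4) = c * num ->
    #|S|%:R <= 2 ^+ n * (num / den).
  move=> rE c_gt0 den_gt0 denE numE; rewrite mulrA ler_pdivlMr // -(ler_pM2l c_gt0).
  rewrite mulrCA [leRHS]mulrCA -denE -numE.
  exact: (@pr_two_independent_bound n t).
have nE : n.+1%:R = n%:R + 1 :> rat by rewrite -addn1 natrD.
have kE (k : nat) : k.+1%:R = k%:R + 1 :> rat by rewrite -addn1 natrD.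
have nR : n%:R = 4 * (n %/ 4)%:R + (n %% 4)%:R :> rat.
  by rewrite {1}(divn_eq n 4) natrD natrM mulrC.
set k := (n %/ 4)%N in nR.
have := ltn_pmod n (isT : (0 < 4)%N).
case: (n %% 4)%N nR => [|[|[|[|//]]]] nR _.
(* In each case [r] is the largest integer at most -1 congruent to [n + 1] modulo 4, and [t] is
   [(n + 1 - r) / 4]. *)
- by apply: (ratio k.+1 (-3) 1); rewrite ?nE ?kE; nra.
- by apply: (ratio k.+1 (-2) 1); rewrite ?nE ?kE; nra.
- by apply: (ratio k.+1 (-1) (n%:R - 2)); rewrite ?nE ?kE; nra.
- by apply: (ratio k.+2 (-4) (n%:R + 1)); rewrite ?nE ?kE; nra.
Qed.
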